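(* Let $W=\{w_1,\dots,w_n\}$ and $M=\{m_1,\dots,m_n\}$ be disjoint, fix a stable marriage mechanism $f$, and let $\mu_{\mathrm{id}}$ be the perfect marriage in which $w_i$ is married to $m_i$ for every $i$. Both the worst-case randomized query complexity (with arbitrary Boolean queries, each a function of the women's profile alone or of the men's profile alone) and the worst-case randomized two-party communication complexity (Alice holding the women's profile $\succ_W$, Bob the men's profile $\succ_M$) of determining whether $f(\succ_W,\succ_M)=\mu_{\mathrm{id}}$, over $\succ_W\in\mathcal F(W,M)$ and $\succ_M\in\mathcal F(M,W)$, are $\Omega(n^2)$.
   Context: $\mathcal F(W,M)$ is the set of profiles assigning each woman a total order on $M$; $\mathcal F(M,W)$ analogously for men. A perfect marriage is a bijection between $W$ and $M$. A pair $(w,m)$ is blocking for $\mu$ if $w$ prefers $m$ to her spouse in $\mu$ and $m$ prefers $w$ to his spouse in $\mu$; $\mu$ is stable if it has no blocking pair. A stable marriage mechanism is a function $f$ from $\mathcal F(W,M)\times\mathcal F(M,W)$ to perfect marriages such that $f(\succ_W,\succ_M)$ is stable with respect to $\succ_W,\succ_M$ for all inputs. Randomized algorithms/protocols must answer correctly with probability at least $2/3$ on every input; complexities are worst case over inputs and asymptotic in $n$. *)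

(* Defs.v *)
From Stdlib Require Import Rdefinitions.
From HB Require Import structures.
From mathcomp Require Import all_boot all_order all_algebra all_fingroup.
From mathcomp Require Import Rstruct.

Set Implicit Arguments.
Unset Strict Implicit.
Unset Printing Implicit Defensive.

Import Order.TTheory GRing.Theory Num.Theory.
Local Open Scope ring_scope.

(* Stable marriage.  Women W = 'I_n (w_i = i), men M = 'I_n (m_i = i).  *)
(* A total order on an n-element set is encoded by its ranking         *)
(* permutation: r x = position of x (0 = most preferred).              *)

(* F(W,M): each woman gets a total order on M *)
Definition profW (n : nat) := {ffun 'I_n -> {perm 'I_n}}.
(* F(M,W): each man gets a total order on W *)
Definition profM (n : nat) := {ffun 'I_n -> {perm 'I_n}}.

(* a perfect marriage: woman w is married to man (mu w) *)
Definition marriage (n : nat) := {perm 'I_n}.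

Definition prefW n (pW : profW n) (w m m' : 'I_n) : bool := (val (pW w m) < val (pW w m'))%N.
Definition prefM n (pM : profM n) (m w w' : 'I_n) : bool := (val (pM m w) < val (pM m w'))%N.

Definition blocking n (pW : profW n) (pM : profM n) (mu : marriage n)
    (w m : 'I_n) : bool :=
  prefW pW w m (mu w) && prefM pM m w ((mu^-1)%g m).

Definition stable n (pW : profW n) (pM : profM n) (mu : marriage n) : Prop :=
  forall w m, ~~ blocking pW pM mu w m.

Definition mechanism (n : nat) :=
  {f : profW n -> profM n -> marriage n | forall pW pM, stable pW pM (f pW pM)}.

Definition mu_id (n : nat) : marriage n := 1%g.

(* Deterministic protocol trees / decision trees.  An internal node is *)
(* a Boolean function of X alone (Alice's bit / a query on the women's *)
(* profile) or of Y alone (Bob's bit / a query on the men's profile);  *)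
(* the next node depends on the answers so far.  Cost = depth.         *)

Inductive ptree (X Y : Type) : Type :=
| PLeaf of bool
| PNodeX of (X -> bool) & ptree X Y & ptree X Y   (* false-branch, true-branch *)
| PNodeY of (Y -> bool) & ptree X Y & ptree X Y.

Fixpoint peval X Y (t : ptree X Y) (x : X) (y : Y) : bool :=
  match t with
  | PLeaf b => b
  | PNodeX q t0 t1 => if q x then peval t1 x y else peval t0 x y
  | PNodeY q t0 t1 => if q y then peval t1 x y else peval t0 x y
  end.

Fixpoint pdepth X Y (t : ptree X Y) : nat :=
  match t with
  | PLeaf _ => 0
  | PNodeX _ t0 t1 => (maxn (pdepth t0) (pdepth t1)).+1
  | PNodeY _ t0 t1 => (maxn (pdepth t0) (pdepth t1)).+1
  end.

(* Randomized (public-coin) protocol: a finite probability distribution *)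
(* over deterministic trees, with real weights.                          *)
Record rprot (X Y : Type) := RProt {
  rp_k : nat;
  rp_w : 'I_rp_k -> R;
  rp_t : 'I_rp_k -> ptree X Y }.
Arguments rp_k {X Y} r.
Arguments rp_w {X Y} r _.
Arguments rp_t {X Y} r _.

Definition is_dist X Y (P : rprot X Y) : Prop :=
  (forall i, 0 <= rp_w P i) /\ \sum_(i < rp_k P) rp_w P i = 1.

Definition rp_cost X Y (P : rprot X Y) : nat :=
  \max_(i < rp_k P | rp_w P i != 0) pdepth (rp_t P i).

Definition rp_computes X Y (P : rprot X Y) (g : X -> Y -> bool) : Prop :=
  is_dist P /\
  forall x y, 2 / 3 <= \sum_(i < rp_k P | peval (rp_t P i) x y == g x y) rp_w P i.

Definition rand_cc_ge X Y (g : X -> Y -> bool) (b : R) : Prop :=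
  forall P : rprot X Y, rp_computes P g -> b <= (rp_cost P)%:R.

(* Randomized query complexity with arbitrary Boolean queries, each a  *)
(* function of the women's profile alone or of the men's profile alone:*)
(* a randomized decision tree is exactly a distribution over ptree.    *)
Definition rand_query_ge n (g : profW n -> profM n -> bool) (b : R) : Prop :=
  rand_cc_ge g b.

Definition rand_comm_ge n (g : profW n -> profM n -> bool) (b : R) : Prop :=
  rand_cc_ge g b.

Definition is_id_problem n (f : mechanism n) : profW n -> profM n -> bool :=
  fun pW pM => sval f pW pM == mu_id n.

(* Main.v *)
Require Import Defs.
From Stdlib Require Import Rdefinitions.
From HB Require Import structures.
From mathcomp Require Import all_boot all_order all_algebra all_fingroup.
From mathcomp Require Import Rstruct ring lra zify.
Set Implicit Arguments.
Unset Strict Implicit.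
Unset Printing Implicit Defensive.
Import Order.TTheory GRing.Theory Num.Theory.
Local Open Scope ring_scope.

(* Split the couples into [k] of a first kind and [l] of a second kind.  A
   woman of the first kind may put some men of the second kind above her own
   man, and a man of the second kind may put some women of the first kind above
   his own woman; everybody else puts the own partner first.  Read as subsets
   [x], [y] of a [k * l] grid, these choices make the identity the only stable
   marriage when [x] and [y] are disjoint, and unstable otherwise.

   Linear randomized complexity of disjointness follows from a corruption bound.
   Draw a random set [D], then [x] inside [D] and [y] inside its complement; a
   meeting pair is obtained by planting a common element [j].  If a rectangle has
   non-negligible mass on disjoint pairs, few coordinates can be biased in it,
   and at an unbiased [j] planting only changes the mass by a constant factor.
   Hence every rectangle gives meeting pairs a constant fraction of its mass on
   disjoint pairs, up to an exponentially small error.  The gap between acceptance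
   probabilities 2/3 and 1/3 is made to beat that constant by passing to a
   constant power of the acceptance probability, which is again a nonnegative
   combination of rectangles. *)

(** * Mass functions on the cube of subsets, and their biased coordinates *)

Section Corruption.
Variables (K : realFieldType) (E : finType).
Implicit Types (v p q : {set E} -> K) (D z : {set E}) (j : E).

Definition mass v : K := \sum_z v z.
Definition mass_in v j : K := \sum_(z : {set E} | j \in z) v z.
Definition mass_out v j : K := \sum_(z : {set E} | j \notin z) v z.
Definition biased v j : bool :=
  (16 * mass_in v j < mass v) || (16 * mass_out v j < mass v).

Lemma mass_in_out v j : mass v = mass_in v j + mass_out v j.
Proof. by rewrite /mass (bigID (fun z : {set E} => j \in z)). Qed.

Lemma sum_sets_const (c : K) : \sum_(z : {set E}) c = c * 2 ^+ #|E|.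
Proof.
rewrite -natrX -[#|E|]cardsT -card_powerset mulr_natr -sumr_const.
by apply: eq_bigl => z; rewrite powersetE subsetT.
Qed.

Lemma mass_le v : (forall z, v z <= 1) -> mass v <= 2 ^+ #|E|.
Proof. by move=> v1; rewrite -[leRHS]mul1r -sum_sets_const; apply: ler_sum. Qed.

(** The exponential moment of the Hamming distance to [J1] on [J] factors over coordinates: [1 + t]
    for each one in [J], 2 for each other one. *)
Lemma sum_mismatch_weight (t : K) (J J1 : {set E}) :
  \sum_(z : {set E}) t ^+ (\sum_(j in J) ((j \in z) != (j \in J1))) =
    (1 + t) ^+ #|J| * 2 ^+ #|~: J|.
Proof.
pose G b j := if (j \in J) && (b != (j \in J1)) then t else 1.
transitivity (\sum_(z in {set E}) \prod_j (if j \in z then G true j else G false j)).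
  apply: eq_bigr => z _; rewrite expr_sum big_mkcond; apply: eq_bigr => j _.
  rewrite /G; case: (j \in J) => /=; last by rewrite if_same.
  by case: (j \in z); case: (j \in J1); rewrite ?expr0 ?expr1.
rewrite -bigA_distr (bigID (mem J)) /=; congr (_ * _).
  rewrite -prodr_const; apply: eq_bigr => j jJ; rewrite /G jJ /=.
  by case: (j \in J1) => //=; rewrite addrC.
rewrite -prodr_const; apply: eq_big => [j|j /negbTE jJ]; first by rewrite inE.
by rewrite /G jJ.
Qed.

(** Of the two factors [3 / 4] on the right, one pays for the weight [s ^+ m] in Markov's
    inequality, the other is the gain per biased coordinate. *)
Fact exponential_moment_base :
  1 + (3 / 4 : K) ^+ 8 <= 2 * (3 / 4) * (3 / 4).
Proof.
have s2 : (3 / 4 : K) ^+ 2 = 9 / 16 by rewrite expr2; field.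
have s4 : (3 / 4 : K) ^+ 4 <= 1 / 3 by rewrite (exprM _ 2 2) s2 expr2; lra.
have s4_ge0 : 0 <= (3 / 4 : K) ^+ 4 by rewrite exprn_ge0 //; lra.
have : (3 / 4 : K) ^+ 8 <= 1 / 3 * (1 / 3) by rewrite (exprD _ 4 4) ler_pM.
by move: (_ ^+ 8) => x; lra.
Qed.

(* A mass that is biased in many coordinates concentrates near one vertex of
   the cube on these coordinates, so Markov's inequality followed by an
   exponential moment bound makes it exponentially small. *)
Lemma biased_mass v : (forall z, 0 <= v z <= 1) ->
  mass v <= 2 * 2 ^+ #|E| * (3 / 4) ^+ #|[set j | biased v j]|.
Proof.
move=> v01; set J := [set j | _]; set m := #|J|.
have v0 z : 0 <= v z by case/andP: (v01 z).
have v1 z : v z <= 1 by case/andP: (v01 z).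
have [m0|m_gt0] := posnP m.
  rewrite m0 expr0 mulr1; apply: le_trans (mass_le v1) _.
  by rewrite ler_peMl ?exprn_ge0 // (ler_nat _ 1 2).
(* [J1] collects the coordinates that most of the mass contains, so on [J] it is the vertex of
   concentration; [d] is the distance to it. *)
pose J1 := [set j | 16 * mass_out v j < mass v].
pose d (z : {set E}) := (\sum_(j in J) ((j \in z) != (j \in J1)))%N.
have sum_d : 16 * (\sum_z v z * (d z)%:R) <= m%:R * mass v.
  under eq_bigr => z _ do rewrite natr_sum mulr_sumr.
  rewrite exchange_big /= mulr_sumr mulr_natl -sumr_const.
  apply: ler_sum => j; rewrite inE => jJ.
  have [jJ1|jJ1] := boolP (j \in J1).
    move: (jJ1); rewrite inE => /ltW; apply: le_trans; rewrite ler_pM2l //.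
    rewrite /mass_out [leRHS]big_mkcond; apply: ler_sum => z _.
    by case: (j \in z) => /=; rewrite ?mulr0 ?mulr1.
  move: jJ; rewrite /biased; move: (jJ1); rewrite inE => /negbTE ->.
  rewrite orbF => /ltW; apply: le_trans; rewrite ler_pM2l //.
  rewrite /mass_in [leRHS]big_mkcond; apply: ler_sum => z _.
  by case: (j \in z) => /=; rewrite ?mulr0 ?mulr1.
have s0 : 0 < 3 / 4 :> K by lra.
have s1 : 3 / 4 <= 1 :> K by lra.
move: (3 / 4 : K) s0 s1 exponential_moment_base => s s0 s1 base.
(* The weight [m - 8 * d z] replaces the indicator of [8 * d z <= m]: it is negative beyond that
   range, and by [sum_d] its average is at least [m / 2]. *)
have markov z : (m%:R - 8 * (d z)%:R) * s ^+ m <= m%:R * (s ^+ 8) ^+ (d z).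
  rewrite -exprM; have [le_dm|lt_md] := leqP (8 * d z) m.
    have le_s : s ^+ m <= s ^+ (8 * d z) by rewrite ler_wiXn2l // ltW.
    apply: le_trans (ler_wpM2l _ le_s) => //.
    by rewrite ler_wpM2r ?exprn_ge0 ?(ltW s0) // lerBlDr lerDl mulr_ge0.
  apply: (@le_trans _ _ 0); last by rewrite mulr_ge0 ?exprn_ge0 ?(ltW s0).
  rewrite mulr_le0_ge0 ?exprn_ge0 ?(ltW s0) // subr_le0.
  by rewrite -natrM ler_nat ltnW.
have moment : (m%:R * mass v - 8 * (\sum_z v z * (d z)%:R)) * s ^+ m <=
              m%:R * ((1 + s ^+ 8) ^+ m * 2 ^+ #|~: J|).
  rewrite -(sum_mismatch_weight _ J J1) /mass !mulr_sumr -sumrB mulr_suml.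
  apply: ler_sum => z _.
  rewrite [X in X * _](_ : _ = v z * (m%:R - 8 * (d z)%:R)); last by ring.
  rewrite -mulrA; apply: le_trans (ler_wpM2l (v0 z) (markov z)) _.
  by rewrite ler_piMl // mulr_ge0 ?exprn_ge0 ?(ltW s0).
have half : m%:R * (mass v * s ^+ m) <= m%:R * (2 * ((1 + s ^+ 8) ^+ m * 2 ^+ #|~: J|)).
  have := ler_wpM2r (exprn_ge0 m (ltW s0)) sum_d.
  move: moment; move: (\sum_z _) => S; move: (_ * 2 ^+ _) => Q.
  by move: (s ^+ m) (mass v) => Y X; lra.
move: half; rewrite ler_pM2l ?ltr0n // => half.
have step : (1 + s ^+ 8) ^+ m <= (2 * s * s) ^+ m.
  by rewrite lerXn2r ?nnegrE ?addr_ge0 ?mulr_ge0 ?exprn_ge0 ?(ltW s0).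
rewrite -(ler_pM2r (exprn_gt0 m s0)).
apply: le_trans half _.
have -> : (2 : K) ^+ #|E| = 2 ^+ m * 2 ^+ #|~: J| by rewrite -exprD cardsC.
rewrite [leRHS](_ : _ = 2 * ((2 * s * s) ^+ m * 2 ^+ #|~: J|)).
  by rewrite ler_pM2l // ler_wpM2r // exprn_ge0.
rewrite !exprMn; set a := 2 ^+ m; set b := 2 ^+ _; set c := s ^+ m.
by clearbody a b c; ring.
Qed.

Fact three_quarters : 0 <= (3 / 4 : K) <= 1.
Proof. by apply/andP; split; lra. Qed.

(** The divisor is [68 = 4 * 17]: two losses of weight 17, each on a fraction [1 / 68] of the
    coordinates, cost half of the disjoint mass. *)
Definition err : K := (3 / 4) ^+ (#|E| %/ 68).

Lemma err_ge0 : 0 <= err.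
Proof. by rewrite exprn_ge0 //; case/andP: three_quarters. Qed.

Lemma err_half : err <= 2 ^- (#|E| %/ 204).
Proof.
have s3 : (3 / 4 : K) ^+ 3 <= 2^-1 by rewrite 2!exprS expr1; lra.
have [s0 s1] := andP three_quarters.
rewrite -exprVn /err (_ : 204 = 68 * 3)%N // divnMA.
apply: le_trans (_ : ((3 / 4) ^+ 3) ^+ (#|E| %/ 68 %/ 3) <= _).
  rewrite -exprM; apply: ler_wiXn2l => //; rewrite mulnC; exact: leq_divM.
by rewrite lerXn2r ?nnegrE ?exprn_ge0 ?invr_ge0.
Qed.

(** Either at most [#|E| / 68] coordinates are biased, or [biased_mass] makes the whole mass
    exponentially small. *)
Lemma biased_loss v : (forall z, 0 <= v z <= 1) ->
  mass v * (#|[set j | biased v j]|)%:R <=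
    #|E|%:R / 68 * mass v + 2 * #|E|%:R * 2 ^+ #|E| * err.
Proof.
move=> v01; have v0 : 0 <= mass v by apply: sumr_ge0 => z _; case/andP: (v01 z).
have := biased_mass v01; set m := #|[set j | _]| => mass_small.
have := err_ge0; rewrite /err; set h := (#|E| %/ 68)%N => err_ge0.
have [le_mh|lt_hm] := leqP m h.
  apply: (@le_trans _ _ (#|E|%:R / 68 * mass v)); last first.
    by rewrite lerDl mulr_ge0 // !mulr_ge0 ?exprn_ge0.
  rewrite mulrC ler_wpM2r // ler_pdivlMr // -natrM ler_nat.
  by apply: leq_trans (leq_divM _ 68); rewrite leq_mul2r le_mh orbT.
have le_mN : m%:R <= #|E|%:R :> K by rewrite ler_nat max_card.
have le_pow : (3 / 4 : K) ^+ m <= (3 / 4) ^+ h.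
  by case/andP: three_quarters => s0 s1; apply: ler_wiXn2l (ltnW lt_hm).
apply: (@le_trans _ _ (2 * 2 ^+ #|E| * (3 / 4) ^+ h * #|E|%:R)).
  apply: ler_pM => //; apply: le_trans mass_small _.
  by rewrite ler_wpM2l // mulr_ge0 ?exprn_ge0.
rewrite [leLHS](_ : _ = 2 * #|E|%:R * 2 ^+ #|E| * (3 / 4) ^+ h); last first.
  by rewrite mulrC !mulrA [_ * 2]mulrC.
by rewrite lerDr !mulr_ge0 ?invr_ge0.
Qed.

(** * Averages over random splits, and corruption of one rectangle *)

Lemma exp8_cube (n : nat) : (8 : K) ^+ n = 2 ^+ n * 2 ^+ n * 2 ^+ n.
Proof. by rewrite -!exprMn -!natrM. Qed.

(** A uniform [z] cut down to [D] is a uniform subset of [D], and all masses keep the common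
    normalization [2 ^+ #|E|]. *)
Definition restr p D z := p (z :&: D).

Lemma sum_in_setU1 j (F : {set E} -> K) :
  \sum_(z : {set E} | j \in z) F z = \sum_(z : {set E} | j \notin z) F (j |: z).
Proof.
rewrite (reindex_onto (fun z => j |: z) (fun z => z :\ j)) => [|z jz].
  apply: eq_bigl => z; rewrite setU11 /=; apply/eqP/idP => [<-|].
    by rewrite setD11.
  exact: setU1K.
exact: setD1K.
Qed.

(** Once [j] has left [D], the restriction cannot see whether [z] contains [j], so both halves of
    the cube carry the mass that avoided [j]. *)
Lemma mass_restr_setD1 p D j : j \in D ->
  mass (restr p (D :\ j)) = 2 * mass_out (restr p D) j.
Proof.
move=> jD; rewrite (mass_in_out _ j) mulr2n mulrDl !mul1r.
congr (_ + _); rewrite /mass_in ?sum_in_setU1; apply: eq_bigr => z jz;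
  congr p; apply/setP => i; rewrite !inE; case: (eqVneq i j) => //= ->.
  by rewrite (negbTE jz).
by rewrite (negbTE jz).
Qed.

Lemma sum_setD1 (H : {set E} -> E -> K) :
  \sum_(D : {set E}) \sum_(j in D) H (D :\ j) j =
    \sum_(D : {set E}) \sum_(j in ~: D) H D j.
Proof.
rewrite (exchange_big_dep xpredT) // [RHS](exchange_big_dep xpredT) //=.
apply: eq_bigr => j _; rewrite sum_in_setU1.
by apply: eq_big => [D|D jD]; rewrite ?inE // setU1K.
Qed.

(** An unnormalized expectation over [8 ^+ #|E|] triples [(D, z, z')]. *)
Definition disjoint_sum (M : {set E} -> {set E} -> K) : K :=
  \sum_(D : {set E}) \sum_z \sum_(z' : {set E}) M (z :&: D) (z' :&: ~: D).

(** The two arguments of [M] meet exactly in the planted [j]. *)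
Definition meeting_sum (M : {set E} -> {set E} -> K) : K :=
  \sum_(D : {set E}) \sum_(j in D) \sum_(z : {set E} | j \in z)
    \sum_(z' : {set E} | j \in z') M (z :&: D) (z' :&: (j |: ~: D)).

(* The case split behind the corruption bound: [a0] and [a1] are the masses
   outside and inside a coordinate, [a] the total, likewise for [b]. *)
Lemma corruption_pointwise (a a0 a1 b b0 b1 : K) :
  0 <= a0 -> 0 <= a1 -> 0 <= b0 -> 0 <= b1 -> a = a1 + a0 -> b = b1 + b0 ->
  a * b0 + a0 * b <= 512 * (a1 * b1) +
    17 * (((16 * a1 < a) || (16 * a0 < a))%:R * (a * b0) +
          ((16 * b1 < b) || (16 * b0 < b))%:R * (a0 * b)).
Proof.
move=> a0_ge0 a1_ge0 b0_ge0 b1_ge0 aE bE.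
have ge_ab1 := mulr_ge0 a1_ge0 b1_ge0.
have ge_ab0 : 0 <= a * b0 by rewrite mulr_ge0 // aE addr_ge0.
have ge_a0b : 0 <= a0 * b by rewrite mulr_ge0 // bE addr_ge0.
have le_ab0 : a * b0 <= a * b by rewrite ler_wpM2l ?aE ?addr_ge0 // bE lerDr.
have le_a0b : a0 * b <= a * b by rewrite ler_wpM2r ?bE ?addr_ge0 // aE lerDr.
have [badF|] := boolP ((16 * a1 < a) || (16 * a0 < a));
  have [badG|] := boolP ((16 * b1 < b) || (16 * b0 < b)).
- by rewrite mul1r mul1r; lra.
(* One-sided bias: the unbiased factor gives [a0 * b <= 16 * (a * b0)], whence the weight
   [17 = 1 + 16]. *)
- rewrite negb_or -!leNgt => /andP[_ good].
  have := ler_wpM2l a0_ge0 good; have : a0 * b0 <= a * b0.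
    by rewrite ler_wpM2r // aE lerDr.
  by rewrite mul1r mul0r; lra.
- rewrite negb_or -!leNgt => /andP[_ good].
  have := ler_wpM2r b0_ge0 good; have : a0 * b0 <= a0 * b.
    by rewrite ler_wpM2l // bE lerDr.
  by rewrite mul1r mul0r; lra.
(* No bias: [a * b <= 16 * 16 * (a1 * b1)], and the left side is at most [2 * (a * b)]. *)
rewrite !negb_or -!leNgt => /andP[good_b _] /andP[good_a _].
have : a * b <= (16 * a1) * (16 * b1).
  by rewrite ler_pM // ?aE ?bE ?addr_ge0 -?aE -?bE.
by rewrite !mul0r; lra.
Qed.

Lemma rectangle_corruption p q :
    (forall x, 0 <= p x <= 1) -> (forall y, 0 <= q y <= 1) ->
  #|E|%:R * disjoint_sum (fun x y => p x * q y) <=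
    2 * (1024 * meeting_sum (fun x y => p x * q y) +
         68 * #|E|%:R * 8 ^+ #|E| * err).
Proof.
move=> p01 q01; set M := fun x y => _.
have p0 D z : 0 <= restr p D z by case/andP: (p01 (z :&: D)).
have q0 D z : 0 <= restr q D z by case/andP: (q01 (z :&: D)).
pose f D := mass (restr p D); pose g D := mass (restr q D).
have f0 D : 0 <= f D by apply: sumr_ge0.
have g0 D : 0 <= g D by apply: sumr_ge0.
have f_le D : f D <= 2 ^+ #|E|.
  by apply: mass_le => z; case/andP: (p01 (z :&: D)).
have g_le D : g D <= 2 ^+ #|E|.
  by apply: mass_le => z; case/andP: (q01 (z :&: D)).
pose badf D j : K := (biased (restr p D) j)%:R.
pose badg D j : K := (biased (restr q D) j)%:R.
have disjE : disjoint_sum M = \sum_(D : {set E}) f D * g (~: D).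
  by apply: eq_bigr => D _; rewrite /f /g /mass big_distrlr.
have meetE : meeting_sum M = \sum_(D : {set E}) \sum_(j in D)
    mass_in (restr p D) j * mass_in (restr q (j |: ~: D)) j.
  apply: eq_bigr => D _; apply: eq_bigr => j _.
  by rewrite /mass_in big_distrlr.
have setCD1 D j : ~: (D :\ j) = j |: ~: D by rewrite setCD setUC.
(* Both splits arise by letting [j] lie on both sides and then expelling it from one; expulsion
   doubles the mass outside [j], turning 512 into 1024. *)
have pointwise D j : j \in D ->
    f D * g (~: D) + f (D :\ j) * g (~: (D :\ j)) <=
    1024 * (mass_in (restr p D) j * mass_in (restr q (j |: ~: D)) j) +
    17 * (badf D j * (f D * g (~: D)) +
          badg (~: (D :\ j)) j * (f (D :\ j) * g (~: (D :\ j)))).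
  move=> jD; rewrite setCD1.
  have -> : g (~: D) = 2 * mass_out (restr q (j |: ~: D)) j.
    rewrite -mass_restr_setD1 ?setU11 // setU1K // inE jD //.
  rewrite /f (mass_restr_setD1 _ jD) -/(f D).
  have := @corruption_pointwise (f D) (mass_out (restr p D) j)
    (mass_in (restr p D) j) (g (j |: ~: D)) (mass_out (restr q (j |: ~: D)) j)
    (mass_in (restr q (j |: ~: D)) j).
  move=> /(_ _ _ _ _ (mass_in_out _ _) (mass_in_out _ _)).
  rewrite /badf /badg /biased -/(f D) -/(g (j |: ~: D)).
  rewrite ?sumr_ge0 // => /(_ isT isT isT isT).
  case: (_ || _); case: (_ || _); rewrite ?mul1r ?mul0r; lra.
(* After reindexing, the terms in [D :\ j] run over [j] outside [D], so each split is counted once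
   per coordinate. *)
have total : \sum_(D : {set E}) \sum_(j in D)
    (f D * g (~: D) + f (D :\ j) * g (~: (D :\ j))) = #|E|%:R * disjoint_sum M.
  under eq_bigr => D _ do rewrite big_split.
  rewrite big_split /= (sum_setD1 (fun D j => f D * g (~: D))) -big_split /= disjE.
  rewrite mulr_sumr; apply: eq_bigr => D _.
  by rewrite !sumr_const -mulrnDr cardsC mulr_natl.
have bound v w (A : {set E}) : (forall z, 0 <= v z <= 1) ->
    0 <= w <= 2 ^+ #|E| ->
    \sum_(j in A) (biased v j)%:R * (mass v * w) <= #|E|%:R / 68 * (mass v * w)
      + 2 * #|E|%:R * (2 ^+ #|E| * 2 ^+ #|E|) * err.
  move=> v01 /andP[w0 w_le].
  have v0 : 0 <= mass v by apply: sumr_ge0 => z _; case/andP: (v01 z).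
  have le_card : \sum_(j in A) (biased v j)%:R <= (#|[set j | biased v j]|)%:R :> K.
    rewrite -sum1_card natr_sum big_mkcond [leRHS]big_mkcond /=.
    by apply: ler_sum => j _; rewrite inE; case: (j \in A); case: (biased v j).
  rewrite -mulr_suml; apply: le_trans (ler_wpM2r (mulr_ge0 v0 w0) le_card) _.
  rewrite [leLHS]mulrA [in leLHS](mulrC _%:R).
  apply: le_trans (ler_wpM2r w0 (biased_loss v01)) _.
  rewrite mulrDl !mulrA lerD2l [leRHS]mulrAC.
  by rewrite ler_wpM2l // mulr_ge0 ?err_ge0 // !mulr_ge0 ?exprn_ge0.
have sum_loss (L : {set E} -> K) :
    (forall D, L D <= #|E|%:R / 68 * (f D * g (~: D)) +
      2 * #|E|%:R * (2 ^+ #|E| * 2 ^+ #|E|) * err) ->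
    \sum_(D : {set E}) L D <=
      #|E|%:R / 68 * disjoint_sum M + 2 * #|E|%:R * 8 ^+ #|E| * err.
  move=> L_le; apply: le_trans (ler_sum _ (fun D _ => L_le D)) _.
  rewrite big_split /= -mulr_sumr -disjE lerD2l.
  by rewrite sum_sets_const exp8_cube [in leRHS]mulrA [leRHS]mulrAC.
have loss_f : \sum_(D : {set E}) \sum_(j in D) badf D j * (f D * g (~: D)) <=
    #|E|%:R / 68 * disjoint_sum M + 2 * #|E|%:R * 8 ^+ #|E| * err.
  by apply: sum_loss => D; apply: bound => [z|]; rewrite ?p01 ?g0 ?g_le.
have loss_g : \sum_(D : {set E}) \sum_(j in D)
      badg (~: (D :\ j)) j * (f (D :\ j) * g (~: (D :\ j))) <=
    #|E|%:R / 68 * disjoint_sum M + 2 * #|E|%:R * 8 ^+ #|E| * err.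
  rewrite (sum_setD1 (fun D j => badg (~: D) j * (f D * g (~: D)))).
  apply: sum_loss => D; rewrite [f D * _]mulrC.
  by apply: bound => [z|]; rewrite ?q01 ?f0 ?f_le.
have : #|E|%:R * disjoint_sum M <= 1024 * meeting_sum M +
  17 * (\sum_(D : {set E}) \sum_(j in D) badf D j * (f D * g (~: D)) +
        \sum_(D : {set E}) \sum_(j in D)
          badg (~: (D :\ j)) j * (f (D :\ j) * g (~: (D :\ j)))).
  clearbody f g badf badg; rewrite -total meetE -big_split !mulr_sumr -big_split.
  apply: ler_sum => D _.
  rewrite /= -big_split !mulr_sumr -big_split; apply: ler_sum => j jD.
  exact: (pointwise D j jD).
move: loss_f loss_g; set L := \sum_(D : {set E}) _; set L' := \sum_(D : {set E}) _.
set X := 8 ^+ #|E|; clear total; clearbody X L L'.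
move: (disjoint_sum M) (meeting_sum M) err => d e t.
by move: #|E|%:R => n; lra.
Qed.

Lemma disjoint_sum_lin (I : Type) (s : seq I) (w : I -> K)
    (a : I -> {set E} -> {set E} -> K) :
  disjoint_sum (fun x y => \sum_(r <- s) w r * a r x y) =
    \sum_(r <- s) w r * disjoint_sum (a r).
Proof.
elim: s => [|r s IHs].
  by rewrite big_nil; do 3![apply: big1 => ? _]; rewrite big_nil.
rewrite big_cons -IHs; do 3![rewrite mulr_sumr -big_split; apply: eq_bigr => ? _].
by rewrite big_cons.
Qed.

Lemma meeting_sum_lin (I : Type) (s : seq I) (w : I -> K)
    (a : I -> {set E} -> {set E} -> K) :
  meeting_sum (fun x y => \sum_(r <- s) w r * a r x y) =
    \sum_(r <- s) w r * meeting_sum (a r).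
Proof.
elim: s => [|r s IHs].
  by rewrite big_nil; do 4![apply: big1 => ? _]; rewrite big_nil.
rewrite big_cons -IHs; do 4![rewrite mulr_sumr -big_split; apply: eq_bigr => ? _].
by rewrite big_cons.
Qed.

Lemma disjoint_sum_ge (M : {set E} -> {set E} -> K) (c : K) :
  (forall x y : {set E}, [disjoint x & y] -> c <= M x y) -> c * 8 ^+ #|E| <= disjoint_sum M.
Proof.
move=> c_le.
rewrite exp8_cube !mulrA -sum_sets_const; apply: ler_sum => D _.
rewrite -sum_sets_const; apply: ler_sum => z _.
rewrite -sum_sets_const; apply: ler_sum => z' _; apply: c_le.
rewrite -setI_eq0 -subset0; apply/subsetP => i; rewrite !inE.
by case: (i \in D); rewrite !andbF.
Qed.

Lemma ler_sum_sets (Q : pred {set E}) (F : {set E} -> K) (c : K) : 0 <= c ->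
  (forall z, Q z -> F z <= c) -> \sum_(z | Q z) F z <= c * 2 ^+ #|E|.
Proof.
move=> c0 F_le; rewrite -sum_sets_const big_mkcond; apply: ler_sum => z _.
by case: ifP => // /F_le.
Qed.

(** The count ignores the three membership constraints on [j], a loss of a factor 8 that the
    constants tolerate. *)
Lemma meeting_sum_le (M : {set E} -> {set E} -> K) (c : K) : 0 <= c ->
    (forall x y : {set E}, ~~ [disjoint x & y] -> M x y <= c) ->
  meeting_sum M <= c * #|E|%:R * 8 ^+ #|E|.
Proof.
move=> c0 le_c.
have -> : c * #|E|%:R * 8 ^+ #|E| =
    c * 2 ^+ #|E| * 2 ^+ #|E| * #|E|%:R * 2 ^+ #|E|.
  rewrite exp8_cube !mulrA; congr (_ * _).
  by rewrite [RHS]mulrAC; congr (_ * _); rewrite mulrAC.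
have c2 : 0 <= c * 2 ^+ #|E| * 2 ^+ #|E| by rewrite !mulr_ge0 ?exprn_ge0.
apply: ler_sum_sets => [|D _]; first by rewrite mulr_ge0.
rewrite mulr_natr -sumr_const big_mkcond; apply: ler_sum => j _.
case: ifP => // jD; apply: ler_sum_sets => [|z jz]; first by rewrite mulr_ge0 ?exprn_ge0.
apply: ler_sum_sets => // z' jz'; apply: le_c; apply/pred0Pn; exists j.
by rewrite /= !inE jz jD jz' eqxx.
Qed.

End Corruption.

(** * Nonnegative combinations of rectangles, and protocol trees *)

Lemma ler_sum_all (K : numDomainType) (I : Type) (a : pred I) (s : seq I)
    (F G : I -> K) : all a s -> (forall i, a i -> F i <= G i) ->
  \sum_(i <- s) F i <= \sum_(i <- s) G i.
Proof.
move=> + le_FG; elim: s => [|i s IHs] /=; first by rewrite !big_nil.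
by case/andP=> /le_FG le_i /IHs le_s; rewrite !big_cons lerD.
Qed.

Section Rectangles.
Variables (K : realFieldType) (X Y : Type).

Definition rect_value (s : seq (K * (X -> bool) * (Y -> bool))) x y : K :=
  \sum_(r <- s) r.1.1 * ((r.1.2 x)%:R * (r.2 y)%:R).

(** The total weight is bounded because every rectangle brings its own additive error into the
    corruption bound. *)
Definition rect_decomp (M : X -> Y -> K) (c : K) : Prop :=
  exists s : seq (K * (X -> bool) * (Y -> bool)),
    [/\ all (fun r => 0 <= r.1.1) s, \sum_(r <- s) r.1.1 <= c
              & forall x y, M x y = rect_value s x y].

Lemma rect_weight_ge0 (s : seq (K * (X -> bool) * (Y -> bool))) :
  all (fun r => 0 <= r.1.1) s -> 0 <= \sum_(r <- s) r.1.1.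
Proof.
elim: s => [|r s IHs] /=; first by rewrite big_nil.
by rewrite big_cons => /andP[? /IHs]; exact: addr_ge0.
Qed.

Lemma rect_decomp1 : rect_decomp (fun _ _ => 1) 1.
Proof.
exists [:: (1, xpredT, xpredT)]; split; rewrite /= ?ler01 ?big_seq1 //.
by move=> x y; rewrite /rect_value big_seq1 /= !mulr1.
Qed.

Lemma rect_decompM M1 M2 c1 c2 : rect_decomp M1 c1 -> rect_decomp M2 c2 ->
  rect_decomp (fun x y => M1 x y * M2 x y) (c1 * c2).
Proof.
case=> s1 [s1_ge0 s1_le M1E] [s2 [s2_ge0 s2_le M2E]].
pose h (r1 r2 : K * (X -> bool) * (Y -> bool)) :=
  (r1.1.1 * r2.1.1, fun x => r1.1.2 x && r2.1.2 x, fun y => r1.2 y && r2.2 y).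
exists [seq h r1 r2 | r1 <- s1, r2 <- s2]; split.
- elim: s1 s1_ge0 {s1_le M1E} => [|r1 s1 IHs1] //= /andP[r1_ge0 /IHs1].
  rewrite all_cat all_map => ->; rewrite andbT.
  by apply: sub_all s2_ge0 => r2 r2_ge0 /=; exact: mulr_ge0.
- rewrite big_allpairs_dep /= -big_distrlr /=.
  by rewrite ler_pM ?rect_weight_ge0.
move=> x y; rewrite M1E M2E /rect_value big_allpairs_dep big_distrlr /=.
apply: eq_bigr => r1 _; apply: eq_bigr => r2 _.
case: (r1.1.2 x) (r1.2 y) (r2.1.2 x) (r2.2 y) => [] [] [] [];
  by rewrite /= ?(mulr0, mul0r, mulr1).
Qed.

Lemma rect_decompX M c t : rect_decomp M c ->
  rect_decomp (fun x y => M x y ^+ t) (c ^+ t).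
Proof.
move=> Mc; elim: t => [|t IHt]; first exact: rect_decomp1.
have [s [s_ge0 s_le sE]] := rect_decompM Mc IHt.
by exists s; split=> [//||x y]; rewrite exprS // -sE.
Qed.

Lemma rect_decomp_sum k (w : 'I_k -> K) (M : 'I_k -> X -> Y -> K)
    (c : 'I_k -> K) : (forall i, 0 <= w i) -> (forall i, rect_decomp (M i) (c i)) ->
  rect_decomp (fun x y => \sum_i w i * M i x y) (\sum_i w i * c i).
Proof.
elim: k w M c => [|k IHk] w M c w_ge0 dec.
  by exists [::]; split=> [//||x y]; rewrite /rect_value big_nil ?big_ord0.
have [s1 [s1_ge0 s1_le s1E]] :=
  IHk _ _ _ (fun i => w_ge0 (lift ord0 i)) (fun i => dec (lift ord0 i)).
have [s0 [s0_ge0 s0_le s0E]] := dec ord0.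
exists ([seq (w ord0 * r.1.1, r.1.2, r.2) | r <- s0] ++ s1); split.
- rewrite all_cat s1_ge0 andbT all_map.
  by apply: sub_all s0_ge0 => r r_ge0 /=; rewrite mulr_ge0.
- rewrite big_cat big_map /= big_ord_recl -mulr_sumr.
  by rewrite lerD // ler_wpM2l.
move=> x y; rewrite /rect_value big_cat big_map /= big_ord_recl s0E.
rewrite s1E mulr_sumr; congr (_ + _).
by apply: eq_bigr => r _ /=; rewrite mulrA.
Qed.

(** One rectangle per accepting leaf; distinct leaves are reached on disjoint rectangles, so their
    indicators add up. *)
Fixpoint accepting (t : ptree X Y) : seq ((X -> bool) * (Y -> bool)) :=
  match t with
  | PLeaf b => nseq b (xpredT, xpredT)
  | PNodeX q t0 t1 =>
      [seq (fun x => ~~ q x && r.1 x, r.2) | r <- accepting t0] ++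
      [seq (fun x => q x && r.1 x, r.2) | r <- accepting t1]
  | PNodeY q t0 t1 =>
      [seq (r.1, fun y => ~~ q y && r.2 y) | r <- accepting t0] ++
      [seq (r.1, fun y => q y && r.2 y) | r <- accepting t1]
  end.

Lemma size_accepting t : (size (accepting t) <= 2 ^ pdepth t)%N.
Proof.
have step a b d0 d1 : (a <= 2 ^ d0 -> b <= 2 ^ d1 -> a + b <= 2 ^ (maxn d0 d1).+1)%N.
  move=> a_le b_le; rewrite expnS mul2n -addnn leq_add //.
    by apply: leq_trans a_le _; rewrite leq_pexp2l // leq_maxl.
  by apply: leq_trans b_le _; rewrite leq_pexp2l // leq_maxr.
elim: t => [[]|q t0 IH0 t1 IH1|q t0 IH0 t1 IH1] //=;
  by rewrite size_cat !size_map; exact: step.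
Qed.

Lemma peval_accepting t x y : (peval t x y)%:R =
  \sum_(r <- accepting t) (r.1 x)%:R * (r.2 y)%:R :> K.
Proof.
elim: t => [[]|q t0 IH0 t1 IH1|q t0 IH0 t1 IH1] /=.
- by rewrite big_seq1 mulr1.
- by rewrite big_nil.
- rewrite big_cat !big_map /=; case: (q x) => /=.
    by rewrite big1 ?add0r // => r _; rewrite mul0r.
  by rewrite [X in _ + X]big1 ?addr0 // => r _; rewrite mul0r.
rewrite big_cat !big_map /=; case: (q y) => /=.
  by rewrite big1 ?add0r // => r _; rewrite mulr0.
by rewrite [X in _ + X]big1 ?addr0 // => r _; rewrite mulr0.
Qed.

Lemma rect_decomp_peval (t : ptree X Y) :
  rect_decomp (fun x y => (peval t x y)%:R) (2 ^+ pdepth t).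
Proof.
exists [seq (1, r.1, r.2) | r <- accepting t]; split.
- by rewrite all_map (eq_all (a2 := xpredT)) ?all_predT // => r /=; rewrite ler01.
- by rewrite big_map /= -(natr_sum _ _ _ (fun=> 1%N)) sum1_size -natrX ler_nat size_accepting.
move=> x y; rewrite /rect_value big_map peval_accepting.
by apply: eq_bigr => r _; rewrite mul1r.
Qed.

End Rectangles.

(** * Corruption for combinations of rectangles *)

Lemma rect_corruption_sum (K : realFieldType) (E : finType)
    (M : {set E} -> {set E} -> K) c : rect_decomp M c ->
  #|E|%:R * disjoint_sum M <=
    2 * (1024 * meeting_sum M + 68 * #|E|%:R * 8 ^+ #|E| * err K E * c).
Proof.
case=> s [s_ge0 s_le ME].
pose rect (r : K * ({set E} -> bool) * ({set E} -> bool)) x y : K :=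
  (r.1.2 x)%:R * (r.2 y)%:R.
have -> : disjoint_sum M = \sum_(r <- s) r.1.1 * disjoint_sum (rect r).
  rewrite -disjoint_sum_lin; do 3![apply: eq_bigr => ? _]; exact: ME.
have -> : meeting_sum M = \sum_(r <- s) r.1.1 * meeting_sum (rect r).
  rewrite -meeting_sum_lin; do 4![apply: eq_bigr => ? _]; exact: ME.
set U := 68 * #|E|%:R * 8 ^+ #|E| * err K E.
have U0 : 0 <= U by rewrite mulr_ge0 ?err_ge0 // !mulr_ge0 ?exprn_ge0.
apply: (@le_trans _ _
  (\sum_(r <- s) r.1.1 * (2 * (1024 * meeting_sum (rect r) + U)))).
  rewrite mulr_sumr; apply: ler_sum_all s_ge0 _ => r r0.
  rewrite mulrCA ler_wpM2l //; apply: rectangle_corruption => x.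
    by case: (r.1.2 x); rewrite ?ler01 ?lexx.
  by case: (r.2 x); rewrite ?ler01 ?lexx.
have Uc := ler_wpM2l U0 s_le; rewrite [leRHS]mulrDr.
rewrite [leLHS](_ : _ = 2 * (1024 * (\sum_(r <- s) r.1.1 * meeting_sum (rect r))) +
  2 * (U * \sum_(r <- s) r.1.1)).
  by rewrite lerD2l ler_wpM2l.
rewrite !mulr_sumr -big_split; apply: eq_bigr => r _ /=.
by clear Uc; clearbody U; move: (meeting_sum _) r.1.1 => e w; ring.
Qed.

(* With the twelfth power of the acceptance probability the ratio
   [(2/3)^12 / (1/3)^12 = 4096] exceeds the loss factor [2048]. *)
Lemma corruption_threshold (K : realFieldType) (E : finType) (d m c : K) :
    0 < #|E|%:R :> K -> (2 / 3) ^+ 12 * 8 ^+ #|E| <= d ->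
    m <= (1 / 3) ^+ 12 * #|E|%:R * 8 ^+ #|E| ->
    #|E|%:R * d <= 2 * (1024 * m + 68 * #|E|%:R * 8 ^+ #|E| * err K E * c) ->
  1 <= err K E * c * 4 ^+ 12.
Proof.
(* Rounding [1 / 3] down to [1 / 4] leaves only powers of two for the final logarithm. *)
have le43 : (4^-1 : K) ^+ 12 <= (1 / 3) ^+ 12.
  by apply: lerXn2r; rewrite ?nnegrE; lra.
have -> : (2 / 3 : K) ^+ 12 = 4096 * (1 / 3) ^+ 12.
  by rewrite -[2 / 3]mulr1 -mulrA exprMn -natrX mul1r mulr1.
move: le43 (err K E); set u := (1 / 3) ^+ 12; clearbody u => le43 e.
have : (0 : K) < 8 ^+ #|E| by rewrite exprn_gt0.
set x := 8 ^+ #|E|; clearbody x; move: (#|E|%:R : K) => n x0 n0 le_d m_le le_nd.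
have le_u : u <= e * c.
  have nx0 : 0 < n * x by rewrite mulr_gt0.
  have := ler_wpM2l (ltW n0) le_d => le_nd'.
  have : 2048 * u * (n * x) <= 136 * (e * c) * (n * x) by lra.
  rewrite ler_pM2r // => le2.
  have u0 : 0 <= u by apply: le_trans le43; rewrite exprn_ge0 ?invr_ge0.
  by clear le43; lra.
have p0 : (0 : K) < 4 ^+ 12 by rewrite exprn_gt0.
by rewrite -ler_pdivrMr // mul1r -exprVn (le_trans le43).
Qed.

(** * Linear randomized cost of set disjointness *)

Section Disjointness.
Variables (X Y : Type) (P : rprot X Y).

Definition accept x y : R := \sum_i rp_w P i * (peval (rp_t P i) x y)%:R.

Lemma rect_decomp_accept : is_dist P -> rect_decomp accept (2 ^+ rp_cost P).
Proof.
case=> w_ge0 w_sum.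
have [s [s_ge0 s_le sE]] :=
  rect_decomp_sum w_ge0 (fun i => rect_decomp_peval R (rp_t P i)).
exists s; split=> //; apply: le_trans s_le _.
apply: (@le_trans _ _ (\sum_i rp_w P i * 2 ^+ rp_cost P)); last first.
  by rewrite -mulr_suml w_sum mul1r.
apply: ler_sum => i _.
(* [rp_cost] ranges only over trees of nonzero weight, so a tree of weight 0 may be arbitrarily
   deep. *)
have [->|wi] := eqVneq (rp_w P i) 0; first by rewrite !mul0r.
rewrite ler_wpM2l // -!natrX ler_nat leq_pexp2l //.
exact: (@leq_bigmax_cond _ (fun i => rp_w P i != 0) (fun i => pdepth (rp_t P i)) i wi).
Qed.

Lemma accept_ge0 x y : is_dist P -> 0 <= accept x y.
Proof. by case=> w_ge0 _; apply: sumr_ge0 => i _; rewrite mulr_ge0. Qed.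

Lemma accept_prob g x y : rp_computes P g ->
  if g x y then 2 / 3 <= accept x y else accept x y <= 1 / 3.
Proof.
case=> -[w_ge0 w_sum] /(_ x y); rewrite big_mkcond; case: (g x y) => /=.
  move=> ge_23; apply: le_trans ge_23 _; apply: ler_sum => i _.
  by case: peval; rewrite ?mulr0 ?mulr1.
move=> ge_23; suff : accept x y + 2 / 3 <= 1 by lra.
rewrite -[leRHS]w_sum; apply: le_trans (lerD (lexx _) ge_23) _.
rewrite -big_split; apply: ler_sum => i _ /=.
by case: peval; rewrite ?mulr0 ?mulr1 ?addr0 ?add0r.
Qed.

(** Logarithms in base 2 of the corruption threshold: 12 comes from the power of the acceptance
    probability, 24 from [4 ^+ 12]. *)
Lemma disjointness_cost (E : finType) (phi : {set E} -> X) (psi : {set E} -> Y)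
    (g : X -> Y -> bool) : (0 < #|E|)%N ->
    (forall x y, g (phi x) (psi y) = [disjoint x & y]) ->
  rp_computes P g -> (#|E| %/ 204 <= 12 * rp_cost P + 24)%N.
Proof.
have third_ge0 := divr_ge0 (@ler01 R) (ler0n R 3).
have two_thirds_ge0 := divr_ge0 (ler0n R 2) (ler0n R 3).
move=> E_gt0 gE Pg; have Pdist := Pg.1.
pose M x y := accept (phi x) (psi y) ^+ 12.
have [s [s_ge0 s_le sE]] := rect_decompX 12 (rect_decomp_accept Pdist).
have dec : rect_decomp M ((2 ^+ rp_cost P) ^+ 12).
  exists [seq (r.1.1, r.1.2 \o phi, r.2 \o psi) | r <- s]; split.
  - by rewrite all_map.
  - by rewrite big_map.
  by move=> x y; rewrite /M sE /rect_value big_map.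
have disj : (2 / 3) ^+ 12 * 8 ^+ #|E| <= disjoint_sum M.
  apply: disjoint_sum_ge => x y dxy; have := accept_prob (phi x) (psi y) Pg.
  rewrite gE dxy => acc; apply: lerXn2r acc; rewrite nnegrE ?accept_ge0 //.
have meet : meeting_sum M <= (1 / 3) ^+ 12 * #|E|%:R * 8 ^+ #|E|.
  apply: meeting_sum_le => [|x y /negbTE dxy]; first by rewrite exprn_ge0.
  have := accept_prob (phi x) (psi y) Pg.
  by rewrite gE dxy => acc; apply: lerXn2r acc; rewrite nnegrE ?accept_ge0.
have N_gt0 : 0 < #|E|%:R :> R by rewrite ltr0n.
have ge1 := corruption_threshold N_gt0 disj meet (rect_corruption_sum dec).
have : 1 <= 2 ^- (#|E| %/ 204) * (2 ^+ rp_cost P) ^+ 12 * 4 ^+ 12 :> R.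
  apply: le_trans ge1 _; rewrite !ler_wpM2r ?exprn_ge0 ?err_half //.
have -> : 4 ^+ 12 = 2 ^+ 24 :> R by rewrite (exprM _ 2 12) -[in RHS]natrX.
rewrite -exprM -mulrA -exprD.
rewrite mulrC ler_pdivlMr ?exprn_gt0 // mul1r -!natrX ler_nat.
by rewrite leq_exp2l // mulnC.
Qed.

End Disjointness.

(** * Total orders from integer keys *)

Section Ranking.
Variables (n : nat) (key : 'I_n -> nat).

(** Since [u < n], this compares keys first and indices second, so equal keys still yield a total
    order. *)
Definition tiebreak (u : 'I_n) : nat := key u * n + u.

Definition below (u : 'I_n) : {set 'I_n} := [set v | (tiebreak v < tiebreak u)%N].

Lemma card_below_lt u : (#|below u| < n)%N.
Proof.
rewrite -[X in (_ < X)%N]card_ord -[#|'I_n|]cardsT; apply: proper_card.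
by rewrite properEneq subsetT andbT; apply/eqP => /setP/(_ u); rewrite !inE ltnn.
Qed.

Definition position u : 'I_n := Ordinal (card_below_lt u).

Lemma position_lt u v : (tiebreak u < tiebreak v)%N -> (position u < position v)%N.
Proof.
move=> lt_uv; apply: proper_card; apply/properP; split.
  by apply/subsetP => z; rewrite !inE => /ltn_trans; apply.
by exists u; rewrite !inE ?ltnn.
Qed.

Lemma tiebreak_lt u v : (key u < key v)%N -> (tiebreak u < tiebreak v)%N.
Proof. by move=> lt_uv; rewrite /tiebreak; have := ltn_ord u; nia. Qed.

Lemma position_inj : injective position.
Proof.
move=> u v eq_uv; have [||eq_t] := ltngtP (tiebreak u) (tiebreak v).
- by move=> /position_lt; rewrite eq_uv ltnn.
- by move=> /position_lt; rewrite eq_uv ltnn.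
have [||eq_k] := ltngtP (key u) (key v).
- by move=> /tiebreak_lt; rewrite eq_t ltnn.
- by move=> /tiebreak_lt; rewrite eq_t ltnn.
by apply: val_inj; move: eq_t; rewrite /tiebreak eq_k => /addnI.
Qed.

Definition ranking : {perm 'I_n} := perm position_inj.

Lemma ranking_lt u v : (key u < key v)%N -> (ranking u < ranking v)%N.
Proof. by move=> /tiebreak_lt/position_lt; rewrite !permE. Qed.

End Ranking.

(** * Reduction from disjointness to stable marriage *)

Section Reduction.
Variables k l : nat.
Implicit Types (x y : {set 'I_k * 'I_l}) (w m : 'I_(k + l)).

(* Smaller keys are preferred.  The [inl] indices are the couples of the first
   kind, the [inr] indices those of the second kind. *)
Definition keyW x w m : nat :=
  match split w, split m with
  | inl i, inr j => if (i, j) \in x then 0 else 2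
  | inl i, inl i' => if i' == i then 1 else 2
  | inr _, _ => m != w
  end.

Definition keyM y m w : nat :=
  match split m, split w with
  | inr j, inl i => if (i, j) \in y then 0 else 2
  | inr j, inr j' => if j' == j then 1 else 2
  | inl _, _ => w != m
  end.

Definition women x : profW (k + l) := [ffun w => ranking (keyW x w)].
Definition men y : profM (k + l) := [ffun m => ranking (keyM y m)].

Lemma prefW_lt x w m m' : (keyW x w m < keyW x w m')%N -> prefW (women x) w m m'.
Proof. by rewrite /prefW ffunE; apply: ranking_lt. Qed.

Lemma prefM_lt y m w w' : (keyM y m w < keyM y m w')%N -> prefM (men y) m w w'.
Proof. by rewrite /prefM ffunE; apply: ranking_lt. Qed.

Lemma splitL i : split (lshift l i : 'I_(k + l)) = inl i.
Proof. exact: (unsplitK (inl i)). Qed.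

Lemma splitR j : split (rshift k j : 'I_(k + l)) = inr j.
Proof. exact: (unsplitK (inr j)). Qed.

(** A displaced woman [i] of the first kind must have a man [j] with [(i, j)] in [x]. By
    disjointness he prefers his own woman, who ranks him first, so these two block. *)
Lemma stable_disjoint x y mu :
  stable (women x) (men y) mu -> [disjoint x & y] -> mu = mu_id (k + l).
Proof.
move=> mu_stable dxy.
have fixL i : mu (lshift l i) = lshift l i.
  apply/eqP; apply: contraT => ne_i; set a := lshift l i in ne_i *.
  have a_first : prefM (men y) a a ((mu^-1)%g a).
    apply: prefM_lt; rewrite /keyM splitL eqxx lt0b; apply: contraNneq ne_i => eq_a.
    by rewrite -[X in mu X]eq_a permKV.
  have := mu_stable a a; rewrite /blocking a_first andbT => a_happy.
  case: (split_ordP (mu a)) => [i' mu_a|j mu_a].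
    have ne_ii : i' != i by apply: contraNneq ne_i => eq_i; rewrite mu_a eq_i.
    by rewrite prefW_lt // in a_happy; rewrite mu_a /keyW !splitL eqxx (negbTE ne_ii).
  have xij : (i, j) \in x.
    apply: contraNT a_happy => xij; apply: prefW_lt.
    by rewrite mu_a /keyW !splitL splitR eqxx (negbTE xij).
  have b_first : prefW (women x) (rshift k j) (rshift k j) (mu (rshift k j)).
    apply: prefW_lt; rewrite /keyW splitR eqxx lt0b; apply/eqP => mu_b.
    by have /perm_inj/eqP := etrans mu_a (esym mu_b); rewrite eq_lrshift.
  have := mu_stable (rshift k j) (rshift k j); rewrite /blocking.
  have -> : (mu^-1)%g (rshift k j) = a by rewrite -mu_a permK.
  rewrite b_first => /negP[]; apply: prefM_lt; rewrite /keyM !splitR splitL eqxx.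
  by rewrite (disjointFr dxy xij).
(* With the first kind fixed, a displaced man of the second kind has a wife of the second kind, whom
   he ranks below his own woman. *)
have fixR j : mu (rshift k j) = rshift k j.
  apply/eqP; apply: contraT => ne_j; set b := rshift k j in ne_j *.
  have b_first : prefW (women x) b b (mu b).
    by apply: prefW_lt; rewrite /keyW splitR eqxx lt0b.
  have := mu_stable b b; rewrite /blocking b_first /= => /negP[].
  apply: prefM_lt; rewrite /keyM !splitR eqxx.
  case: (split_ordP ((mu^-1)%g b)) => [i|j'] inv_b;
    have := congr1 mu inv_b; rewrite permKV.
    by rewrite fixL => /eqP; rewrite eq_rlshift.
  move=> eq_b; case: eqP => // eq_j.
  by case/eqP: ne_j; rewrite [RHS]eq_b eq_j.
apply/permP => w; rewrite perm1; case: (split_ordP w) => [i ->|j ->] //.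
Qed.

(** A common [(i, j)] makes woman [i] and man [j] block the identity. Stability alone thus decides
    the answer, whatever the mechanism. *)
Lemma is_id_disjoint (f : mechanism (k + l)) x y :
  is_id_problem f (women x) (men y) = [disjoint x & y].
Proof.
have f_stable := svalP f (women x) (men y).
rewrite /is_id_problem; apply/eqP/idP => [f_id|]; last exact: stable_disjoint.
rewrite -setI_eq0; apply: contraT => /set0Pn[[i j]]; rewrite inE => /andP[xij yij].
have := f_stable (lshift l i) (rshift k j); rewrite f_id /blocking invg1 !perm1.
by rewrite prefW_lt ?prefM_lt // /keyW /keyM !splitL !splitR eqxx ?xij ?yij.
Qed.

End Reduction.

(** * The quadratic lower bound *)

Lemma is_id_cost n (f : mechanism n) (P : rprot (profW n) (profM n)) :
  (300 <= n)%N -> rp_computes P (is_id_problem f) -> (n ^ 2 <= rp_cost P * 2 ^ 14)%N.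
Proof.
move=> n_large; have := half_leq n_large; have := odd_double_half n.
(* Nearly equal halves give a grid of about [n ^ 2 / 4] cells. *)
rewrite -addnn; set k := n./2; set l := (odd n + k)%N => n_eq k_large.
have nE : n = (k + l)%N by rewrite /l; lia.
have l_le : (k <= l <= k.+1)%N by rewrite /l; case: (odd n); lia.
move=> Pf; clear n_eq n_large; clearbody l; clearbody k; subst n.
have := @disjointness_cost _ _ P ('I_k * 'I_l)%type (women (l := l)) (men (l := l)).
move=> /(_ _ _ (is_id_disjoint f) Pf); rewrite card_prod !card_ord.
have -> : (0 < k * l)%N by nia.
move=> /(_ isT); rewrite -ltnS ltn_divLR // => kl_lt.
(* This forces a cost of at least 8, which absorbs the additive constants, as the slope
   [4 * 204 * 12 = 9792] is well below [2 ^ 14]. *)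
have kl_ge : (150 * 150 <= k * l)%N by apply: leq_mul; lia.
have sq_le : ((k + l) ^ 2 <= 4 * (k * l) + 1)%N.
  have lE : l = k \/ l = k.+1 by lia.
  by rewrite -mulnn; case: lE => ->; nia.
by move: kl_lt kl_ge sq_le; move: (k * l)%N ((k + l) ^ 2)%N (rp_cost P); lia.
Qed.

(* For every family of stable marriage mechanisms (one for each n), both   *)
(* complexities of deciding f(pW,pM) = mu_id are Omega(n^2).              *)
Theorem theorem25 :
  forall F : forall n : nat, mechanism n,
  exists c : R, 0 < c /\
  exists N : nat, forall n : nat, (N <= n)%N ->
    rand_query_ge (is_id_problem (F n)) (c * ((n ^ 2)%N)%:R) /\
    rand_comm_ge (is_id_problem (F n)) (c * ((n ^ 2)%N)%:R).
Proof.
move=> F; exists (2 ^- 14); split; first by rewrite invr_gt0 exprn_gt0.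
exists 300 => n n_large.
have bound P : rp_computes P (is_id_problem (F n)) ->
    2 ^- 14 * (n ^ 2)%N%:R <= (rp_cost P)%:R :> R.
  move=> Pf; rewrite mulrC ler_pdivrMr ?exprn_gt0 // -natrX -natrM ler_nat.
  exact: is_id_cost n_large Pf.
by split=> P; exact: bound.
Qed.
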